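(* Let $1\le k\le d$ be integers and let $\lambda\in(0,1]$. For $t\ge 1$ let $\mathbf V^{(t)}\in\mathbb R^{k\times d}$ and $\boldsymbol\sigma^{(t)}\in\mathbb R^k$ be the loadings and singular values output by incremental PCA after the $t$-th window of a data stream. Define the raw importance scores $$s_j^{(t)}=\sum_{i=1}^k \sigma_i^{(t)}\bigl(V_{ij}^{(t)}\bigr)^2,\qquad j=1,\dots,d,$$ and, from initial values $\bar s_j^{(0)}$, the smoothed importance scores $$\bar s_j^{(t)}=\lambda\,\bar s_j^{(t-1)}+(1-\lambda)\,s_j^{(t)},\qquad t\ge 1.$$ If, under a stationary distribution, incremental PCA converges to the true top-$k$ eigenspace, that is, $\mathbf V^{(t)}\to\mathbf V^*$ and $\boldsymbol\sigma^{(t)}\to\boldsymbol\sigma^*$ as $t\to\infty$, then the smoothed importance scores converge: $$\bar s_j^{(t)}\longrightarrow s_j^*=\sum_{i=1}^k\sigma_i^*\,(V_{ij}^* )^2\qquad\text{for all } j=1,\dots,d .$$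
   Context: There are $d$ sensor channels and $k$ retained principal components. Row $i$ of the loading matrix is the $i$-th principal direction, and $\sigma_i$ is the corresponding singular value; $\mathbf V^*\in\mathbb R^{k\times d}$ and $\boldsymbol\sigma^*\in\mathbb R^k$ denote the true top-$k$ directions and singular values. The parameter $\lambda$ is the forgetting factor of the exponential moving average.
   Formalization: The forgetting factor is restricted to 0 < λ < 1: at λ = 1 the smoothed scores stay equal to their initial values, so the claim fails (e.g. k = d = 1, V = σ = 1, initial value 0, while s* = 1). *)

(* Defs.v *)
From HB Require Import structures.
From mathcomp Require Import all_boot all_order all_algebra.
From mathcomp Require Import all_classical all_reals all_analysis.

Set Implicit Arguments.
Unset Strict Implicit.
Unset Printing Implicit Defensive.

Import Order.TTheory GRing.Theory Num.Theory.
Import numFieldNormedType.Exports.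

Local Open Scope ring_scope.

Definition importance_score (R : realType) (k d : nat)
    (V : 'M[R]_(k, d)) (sigma : 'rV[R]_k) (j : 'I_d) : R :=
  \sum_(i < k) sigma 0 i * V i j ^+ 2.

(* Windows are numbered from 1, so [V 0] and [sigma 0] are never read.
   With [lambda = 1] the sequence is constantly [sbar0 j], so its limit then
   has nothing to do with the data: convergence results need [lambda != 1]. *)
Fixpoint smoothed_score (R : realType) (k d : nat) (lambda : R)
    (sbar0 : 'I_d -> R) (V : nat -> 'M[R]_(k, d)) (sigma : nat -> 'rV[R]_k)
    (t : nat) (j : 'I_d) : R :=
  if t is t'.+1 then
    lambda * smoothed_score lambda sbar0 V sigma t' j
      + (1 - lambda) * importance_score (V t) (sigma t) j
  else sbar0 j.

(* Main.v *)
(* The error [e t = sbar t - sstar] satisfies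
   [e t.+1 = lambda * e t + (1 - lambda) * (s t.+1 - sstar)]. Once the input
   error is below [h], the convex combination gives
   [|e (N + n)| <= lambda ^+ n * |e N| + h], and [lambda < 1] kills the first
   term. The raw scores converge because they are continuous in the entries of
   [V] and [sigma]. *)

Require Import Defs.
From HB Require Import structures.
From mathcomp Require Import all_boot all_order all_algebra.
From mathcomp Require Import all_classical all_reals all_analysis.
From mathcomp Require Import ring.

Import Order.TTheory GRing.Theory Num.Theory.
Import numFieldNormedType.Exports.

Local Open Scope classical_set_scope.
Local Open Scope ring_scope.

Lemma cvg_exponential_average (R : realType) (a l : R) (u v : R^nat) :
    0 <= a < 1 -> (forall n, u n.+1 = a * u n + (1 - a) * v n.+1) ->
  v n @[n --> \oo] --> l -> u n @[n --> \oo] --> l.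
Proof.
move=> /andP[a0 a1] uS /cvgrPdist_le vl; apply/cvgrPdist_le => e e0.
have e20 : 0 < e / 2 by rewrite divr_gt0.
have [N _ vN] := vl _ e20.
(* The slack [e / 2] does not accumulate: it is a fixed point of [x |-> a * x + (1 - a) * (e / 2)],
   so each step only damps the initial gap by [a]. *)
have bound n : `|l - u (n + N)%N| <= `|l - u N| * a ^+ n + e / 2.
  elim: n => [|n IHn]; first by rewrite add0n expr0 mulr1 lerDl ltW.
  have a1' : 0 <= 1 - a by rewrite subr_ge0 ltW.
  rewrite addSn uS.
  have -> : l - (a * u (n + N)%N + (1 - a) * v (n + N).+1) =
            a * (l - u (n + N)%N) + (1 - a) * (l - v (n + N).+1) by ring.
  apply: (le_trans (ler_normD _ _)).
  rewrite !normrM (ger0_norm a0) (ger0_norm a1').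
  have vn : `|l - v (n + N).+1| <= e / 2
    by apply: vN; rewrite /= ltnW// ltnS leq_addl.
  apply: (le_trans (lerD (ler_wpM2l a0 IHn) (ler_wpM2l a1' vn))).
  by rewrite le_eqVlt; apply/orP; left; apply/eqP; rewrite exprS; ring.
(* [N] is fixed by now, so the gap [|l - u N|] is a constant, and geometric decay brings its
   contribution below the other [e / 2]. *)
have /cvgr0Pnorm_le/(_ _ e20)[M _ geoM] : geometric `|l - u N| a @ \oo --> 0.
  by apply: cvg_geometric; rewrite ger0_norm.
(* [bound] counts steps from [N], so the decay needs [n - N >= M]. *)
exists (M + N)%N => // n /= MNn.
have Nn : (N <= n)%N := leq_trans (leq_addl _ _) MNn.
rewrite -(subnK Nn) (splitr e); apply: (le_trans (bound _)); rewrite lerD2r.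
by apply: (le_trans (ler_norm _)); apply: geoM; rewrite /= leq_subRL// addnC.
Qed.

Lemma cvg_mx_entry (K : numFieldType) (T : Type) (F : set_system T)
    (m n : nat) (M : T -> 'M[K]_(m, n)) (M' : 'M[K]_(m, n))
    (i : 'I_m) (j : 'I_n) :
  M x @[x --> F] --> M' -> M x i j @[x --> F] --> M' i j.
Proof.
move=> MM'.
exact: (@cvg_comp _ _ _ M (fun A => A i j) F _ _ MM' (@coord_continuous K m n i j M')).
Qed.

Lemma cvg_importance_score (R : realType) (k d : nat) (V : nat -> 'M[R]_(k, d))
    (sigma : nat -> 'rV[R]_k) (V' : 'M[R]_(k, d)) (sigma' : 'rV[R]_k) (j : 'I_d) :
    V t @[t --> \oo] --> V' -> sigma t @[t --> \oo] --> sigma' ->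
  importance_score (V t) (sigma t) j @[t --> \oo] --> importance_score V' sigma' j.
Proof.
move=> VV' ss'; apply: cvg_big => [|i _]; first exact: add_continuous.
have si : sigma t 0 i @[t --> \oo] --> sigma' 0 i by exact: cvg_mx_entry.
have Vij : V t i j @[t --> \oo] --> V' i j by exact: cvg_mx_entry.
(* [x ^+ 2] is convertible to [x * x], so the limit of a product also covers the square. *)
exact: (cvgM si (cvgM Vij Vij)).
Qed.

Theorem proposition2 (R : realType) (k d : nat) (hk : (1 <= k)%N)
    (hkd : (k <= d)%N) (lambda : R) (hlambda : 0 < lambda <= 1)
    (hlambda1 : lambda != 1)
    (V : nat -> 'M[R]_(k, d)) (sigma : nat -> 'rV[R]_k)
    (Vstar : 'M[R]_(k, d)) (sigmastar : 'rV[R]_k) (sbar0 : 'I_d -> R)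
    (hV : V t @[t --> \oo] --> Vstar)
    (hsigma : sigma t @[t --> \oo] --> sigmastar) :
  forall j : 'I_d,
    smoothed_score lambda sbar0 V sigma t j @[t --> \oo]
      --> importance_score Vstar sigmastar j.
Proof.
move=> j; have /andP[lambda0 lambda1] := hlambda.
have lambda_lt1 : 0 <= lambda < 1 by rewrite ltW//= lt_neqAle hlambda1.
(* The recurrence holds by computation: [smoothed_score] at [n.+1] reads the raw score of window
   [n.+1]. *)
apply: (cvg_exponential_average _ _ _ _
  (fun t => importance_score (V t) (sigma t) j) lambda_lt1) => //.
exact: cvg_importance_score.
Qed.
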